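(* Let $1\le k\le n$, let $A\in\mathbb{R}^{n\times n}$ be symmetric and nonsingular, and let $J\in\mathbb{R}^{k\times k}$ be symmetric with $J^2=I_k$. Assume that $\mathrm{i}_+(J)\le \mathrm{i}_+(A)$ and $\mathrm{i}_-(J)\le \mathrm{i}_-(A)$. Then the set $$\mathrm{iSt}_{A,J}(k,n)=\{X\in\mathbb{R}^{n\times k} : X^TAX=J\}$$ is a closed, embedded submanifold of $\mathbb{R}^{n\times k}$ of dimension $nk-\frac12 k(k+1)$.
   Context: For a real symmetric matrix $M$, $\mathrm{i}_+(M)$ and $\mathrm{i}_-(M)$ denote the numbers of positive and negative eigenvalues of $M$ (counted with multiplicity), respectively. The condition $\mathrm{i}_\pm(J)\le \mathrm{i}_\pm(A)$ is a standing assumption (it guarantees that the set is nonempty). $\mathrm{iSt}_{A,J}(k,n)$ is called the indefinite Stiefel manifold. *)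

(* Defs.v *)
From HB Require Import structures.
From mathcomp Require Import all_boot all_order all_algebra.
From mathcomp Require Import all_classical all_reals all_analysis.
From mathcomp Require polyrcf.

Set Implicit Arguments.
Unset Strict Implicit.
Unset Printing Implicit Defensive.

Import Order.TTheory GRing.Theory Num.Theory.
Import numFieldNormedType.Exports.
Local Open Scope classical_set_scope.
Local Open Scope ring_scope.

(* Eigenvalues are counted with their multiplicity as roots of [char_poly M];
   [rootsR] lists the distinct real roots, which for a symmetric [M] are all
   the complex ones. *)
Definition inertia_pos (R : realType) (m : nat) (M : 'M[R]_m) : nat :=
  (\sum_(x <- polyrcf.rootsR (char_poly M) | (0 < x)%R) mup x (char_poly M))%N.

Definition inertia_neg (R : realType) (m : nat) (M : 'M[R]_m) : nat :=
  (\sum_(x <- polyrcf.rootsR (char_poly M) | (x < 0)%R) mup x (char_poly M))%N.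

(* Class C^r on an open set [U]; intended for finite-dimensional [V] and [W],
   where C^(r+1) amounts to differentiability together with all directional
   derivatives being C^r. *)
Fixpoint Cr_on (R : realType) (V W : normedModType R) (r : nat)
    (U : set V) (f : V -> W) : Prop :=
  match r with
  | 0%N => forall x, U x -> {for x, continuous f}
  | r'.+1 => (forall x, U x -> differentiable f x) /\
             (forall v : V, Cr_on r' U (fun x => 'D_v f x))
  end.

Definition smooth_on (R : realType) (V W : normedModType R)
    (U : set V) (f : V -> W) : Prop :=
  forall r : nat, Cr_on r U f.

Definition smooth_diffeo (R : realType) (V W : normedModType R)
    (U : set V) (O : set W) (phi : V -> W) (psi : W -> V) : Prop :=
  [/\ open U, open O,
      smooth_on U phi & smooth_on O psi] /\
  [/\ forall x, U x -> O (phi x), forall y, O y -> U (psi y),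
      forall x, U x -> psi (phi x) = x & forall y, O y -> phi (psi y) = y].

(* A nonempty subset of the space of p x q matrices which, around each of its
   points, is carried by a diffeomorphism between open subsets of R^(p x q) and
   R^(p q) onto a slice R^d x {0}.  The condition [d <= p * q] matters: for
   larger [d] the slice would be the whole space. *)
Definition embedded_submanifold (R : realType) (p q : nat)
    (S : set 'M[R]_(p, q)) (d : nat) : Prop :=
  [/\ S !=set0, (d <= p * q)%N &
    forall x0, S x0 ->
      exists (U : set 'M[R]_(p, q)) (O : set 'rV[R]_(p * q))
             (phi : 'M[R]_(p, q) -> 'rV[R]_(p * q))
             (psi : 'rV[R]_(p * q) -> 'M[R]_(p, q)),
        [/\ smooth_diffeo U O phi psi, U x0 &
            forall x, U x ->
              (S x <-> forall j : 'I_(p * q), (d <= j)%N -> phi x ord0 j = 0)]].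

Definition iSt (R : realType) (n k : nat) (A : 'M[R]_n) (J : 'M[R]_k) :
    set 'M[R]_(n, k) :=
  [set X | X^T *m A *m X = J].

(* Main.v *)
From HB Require Import structures.
Require Import Defs.
From mathcomp Require Import all_boot all_order all_algebra.
From mathcomp Require Import all_classical all_reals all_analysis.
From mathcomp Require Import perm zify ring lra.
From mathcomp Require Import complex.
From mathcomp Require polyrcf.

(* Fix a point X0 of the set and put L = X0^T A.  The chart at X0 is rational, so
   no inverse function theorem is needed.  The Cayley transform H = cayley X
   turns X^T A X = J into the equation 2 (L H + (L H)^T) + Q(H) = 0, where Q(H)
   depends only on the component of H that is A-orthogonal to X0.  The shear
   H + X0 J Q(H) / 4, whose inverse has the opposite sign, absorbs Q and leaves
   the linear equation L H' + (L H')^T = 0.  Since L has the right inverse X0 J,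
   this equation has rank k (k + 1) / 2, and a linear change of coordinates turns
   it into the vanishing of the last coordinates.

   For nonemptiness, A and J are diagonalized orthogonally and the eigenvalues
   of J, which are 1 and -1, are matched injectively with eigenvalues of A of
   the same sign. *)

Set Implicit Arguments.
Unset Strict Implicit.
Unset Printing Implicit Defensive.

Import Order.TTheory GRing.Theory Num.Theory.
Import numFieldNormedType.Exports.
Local Open Scope classical_set_scope.
Local Open Scope ring_scope.

(** * Differential calculus of matrix-valued maps *)

(** The first-order expansion at [x] depends only on the germ there, so ['d f x] also serves as the
    differential of [g]. *)
Lemma near_eq_differentiable (R : realType) (V W : normedModType R)
    (f g : V -> W) (x : V) :
  (\near x, f x = g x) -> differentiable f x -> differentiable g x.
Proof.
move=> fg dfx.
have [dfc dfE] := (diff_locallyP _ _).1 dfx.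
have gE : g \o shift x = cst (g x) + 'd f x +o_ (0 : V) id.
  apply/eqaddoP => _/posnumP[e].
  have /eqaddoP/(_ _ (gt0 e)) := dfE.
  have fg0 : \forall y \near (0 : V), f (y + x) = g (y + x).
    by move: fg; rewrite (near_shift 0); apply: filterS => y /=; rewrite subr0.
  apply: filterS2 fg0 => y /= fgy.
  by rewrite -[(g \o _ - _) y]/(g (y + x) - (g x + 'd f x y)) -fgy
    -(nbhs_singleton fg).
apply/diff_locallyP; by rewrite (diff_unique dfc gE); split.
Qed.

Section Cr_calculus.
Context {R : realType} {V : normedModType R}.
Implicit Types (W : normedModType R) (U : set V).

(** On an open set, agreement on [U] is agreement near each of its points, hence passes to
    directional derivatives. The rules below can thus use derivative formulas that hold only on
    [U]. *)
Lemma Cr_on_ext W r U (f g : V -> W) : open U ->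
  (forall x, U x -> f x = g x) -> Cr_on r U f -> Cr_on r U g.
Proof.
move=> oU; have nearU x : U x -> \near x, U x by move=> Ux; exact: open_nbhs_nbhs.
elim: r f g => [|r IH] f g fg /=.
  move=> Cf x Ux; rewrite /prop_for /continuous_at -(fg x Ux).
  apply: cvg_trans (Cf x Ux); apply: near_eq_cvg.
  by apply: filterS (nearU _ Ux) => y /fg.
have nfg x : U x -> \near x, f x = g x.
  by move=> Ux; apply: filterS (nearU _ Ux) => y /fg.
move=> [df Df]; split=> [x Ux|v]; first exact: near_eq_differentiable (nfg x Ux) (df x Ux).
by apply: IH (Df v) => x Ux; apply: near_eq_derive; exact: nfg.
Qed.

Lemma Cr_onW W r U (f : V -> W) : Cr_on r.+1 U f -> Cr_on r U f.
Proof.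
elim: r f => [|r IH] f [df Df]; last by split=> // v; exact: IH (Df v).
by move=> x Ux; exact/differentiable_continuous/df.
Qed.

Lemma Cr_on_cst W r U (w : W) : Cr_on r U (cst w : V -> W).
Proof.
elim: r w => [|r IH] w; first by move=> x _; exact: cst_continuous.
split=> [x _|v]; first exact: differentiable_cst.
suff -> : (fun x : V => 'D_v (cst w) x) = cst (0 : W) by [].
by apply/funext => x; rewrite derive_cst.
Qed.

Lemma Cr_on_linear W r U (f : {linear V -> W}) :
  continuous f -> Cr_on r U f.
Proof.
move=> cf; case: r => [|r]; first by move=> x _; exact: cf.
split=> [x _|v]; first exact: linear_differentiable.
suff -> : (fun x : V => 'D_v f x) = cst (f v) by exact: Cr_on_cst.
apply/funext => x; rewrite deriveE; last exact: linear_differentiable.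
by rewrite diff_lin.
Qed.

Lemma Cr_onD W r U (f g : V -> W) : open U ->
  Cr_on r U f -> Cr_on r U g -> Cr_on r U (fun x => f x + g x).
Proof.
move=> oU; elim: r f g => [|r IH] f g.
  by move=> Cf Cg x Ux; apply: continuousD; [exact: Cf|exact: Cg].
move=> [df Df] [dg Dg]; split=> [x Ux|v].
  by apply: differentiableD; [exact: df|exact: dg].
apply: Cr_on_ext (IH _ _ (Df v) (Dg v)) => // x Ux.
by rewrite -deriveD//; apply: diff_derivable; [exact: df|exact: dg].
Qed.

Lemma Cr_on_sum W r U (I : Type) (s : seq I) (P : pred I) (f : I -> V -> W) :
  open U -> (forall i, Cr_on r U (f i)) ->
  Cr_on r U (fun x => \sum_(i <- s | P i) f i x).
Proof.
move=> oU Cf; elim: s => [|i s IH].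
  apply: Cr_on_ext (Cr_on_cst r U 0) => // x _.
  by rewrite big_nil.
case Pi: (P i); last first.
  by apply: Cr_on_ext IH => // x _; rewrite big_cons Pi.
by apply: Cr_on_ext (Cr_onD oU (Cf i) IH) => // x _; rewrite big_cons Pi.
Qed.

Lemma Cr_onZl W r U (f : V -> R) (w : W) : open U ->
  Cr_on r U f -> Cr_on r U (fun x => f x *: w).
Proof.
move=> oU; elim: r f => [|r IH] f.
  by move=> Cf x Ux; exact: (continuousZr_tmp (s := f) (Cf x Ux)).
move=> [df Df]; split=> [x Ux|v].
  by apply: differentiableZl; exact: df.
apply: Cr_on_ext (IH _ (Df v)) => // x Ux.
have dfx := df x Ux.
by rewrite !deriveE ?diffZl//; exact: differentiableZl.
Qed.

Lemma Cr_onM r U (f g : V -> R) : open U ->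
  Cr_on r U f -> Cr_on r U g -> Cr_on r U (fun x => f x * g x).
Proof.
move=> oU; elim: r f g => [|r IH] f g.
  by move=> Cf Cg x Ux; apply: continuousM; [exact: Cf|exact: Cg].
move=> Cf Cg; have [df Df] := Cf; have [dg Dg] := Cg; split=> [x Ux|v].
  by apply: differentiableM; [exact: df|exact: dg].
apply: Cr_on_ext (Cr_onD oU (IH _ _ (Cr_onW Cf) (Dg v))
                            (IH _ _ (Cr_onW Cg) (Df v))) => // x Ux.
by apply/esym/deriveM; apply: diff_derivable; [exact: df|exact: dg].
Qed.

Lemma Cr_on_prod r U (I : Type) (s : seq I) (P : pred I) (f : I -> V -> R) :
  open U -> (forall i, Cr_on r U (f i)) ->
  Cr_on r U (fun x => \prod_(i <- s | P i) f i x).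
Proof.
move=> oU Cf; elim: s => [|i s IH].
  apply: Cr_on_ext (Cr_on_cst r U (1 : R)) => // x _.
  by rewrite big_nil.
case Pi: (P i); last first.
  by apply: Cr_on_ext IH => // x _; rewrite big_cons Pi.
by apply: Cr_on_ext (Cr_onM oU (Cf i) IH) => // x _; rewrite big_cons Pi.
Qed.

(** The derivative of [1 / f] is [- Df / f ^ 2], so order [r + 1] follows from order [r] for [1 / f]
    and for [Df]. *)
Lemma Cr_onV r U (f : V -> R) : open U -> (forall x, U x -> f x != 0) ->
  Cr_on r U f -> Cr_on r U (fun x => (f x)^-1).
Proof.
move=> oU f0; elim: r f f0 => [|r IH] f f0.
  by move=> Cf x Ux; apply: continuousV; [exact: f0|exact: Cf].
move=> Cf; have [df Df] := Cf; split=> [x Ux|v].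
  by apply: differentiableV; [exact: df|exact: f0].
have CV := IH f f0 (Cr_onW Cf).
have := Cr_onM oU (Cr_on_cst r U (-1 : R)) (Cr_onM oU (Cr_onM oU CV CV) (Df v)).
apply: Cr_on_ext => // x Ux.
rewrite deriveV ?f0//; last by apply: diff_derivable; exact: df.
by rewrite /cst -mulrA mulN1r -exprVn expr2 scaleNr -[_ *: _]/(_ * _) mulrA.
Qed.

End Cr_calculus.

(** * Entrywise smoothness of matrix-valued maps *)

Section smooth_matrices.
Context {R : realType} {V : normedModType R} (U : set V) (oU : open U).

(** Working entrywise reduces matrix operations to scalar calculus. The source [V] is arbitrary, so
    that the rules can be applied one after another to a composite formula. *)
Definition smooth_mx_on m n (f : V -> 'M[R]_(m, n)) : Prop :=
  forall r i j, Cr_on r U (fun x => f x i j).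

Lemma smooth_mx_cst m n (M : 'M[R]_(m, n)) : smooth_mx_on (fun _ => M).
Proof. by move=> r i j; exact: (Cr_on_cst r U (M i j)). Qed.

Lemma smooth_mxD m n (f g : V -> 'M[R]_(m, n)) :
  smooth_mx_on f -> smooth_mx_on g -> smooth_mx_on (fun x => f x + g x).
Proof.
move=> Cf Cg r i j; apply: Cr_on_ext (Cr_onD oU (Cf r i j) (Cg r i j)) => // x _.
by rewrite mxE.
Qed.

Lemma smooth_mxZ m n (a : R) (f : V -> 'M[R]_(m, n)) :
  smooth_mx_on f -> smooth_mx_on (fun x => a *: f x).
Proof.
move=> Cf r i j.
apply: Cr_on_ext (Cr_onM oU (Cr_on_cst r U a) (Cf r i j)) => // x _.
by rewrite mxE.
Qed.

Lemma smooth_mxN m n (f : V -> 'M[R]_(m, n)) :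
  smooth_mx_on f -> smooth_mx_on (fun x => - f x).
Proof.
move=> Cf; rewrite (_ : (fun _ => _) = fun x => (-1) *: f x); first exact: smooth_mxZ.
by apply/funext => x; rewrite scaleN1r.
Qed.

Lemma smooth_mxM m n p (f : V -> 'M[R]_(m, n)) (g : V -> 'M[R]_(n, p)) :
  smooth_mx_on f -> smooth_mx_on g -> smooth_mx_on (fun x => f x *m g x).
Proof.
move=> Cf Cg r i j.
apply: Cr_on_ext (Cr_on_sum (index_enum _) predT oU
  (fun l => Cr_onM oU (Cf r i l) (Cg r l j))) => // x _.
by rewrite mxE.
Qed.

Lemma smooth_mx_tr m n (f : V -> 'M[R]_(m, n)) :
  smooth_mx_on f -> smooth_mx_on (fun x => (f x)^T).
Proof.
by move=> Cf r i j; apply: Cr_on_ext (Cf r j i) => // x _; rewrite mxE.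
Qed.

Lemma smooth_mx_det n (f : V -> 'M[R]_n) :
  smooth_mx_on f -> forall r, Cr_on r U (fun x => \det (f x)).
Proof.
move=> Cf r; rewrite /determinant; apply: Cr_on_sum => // s.
apply: Cr_onM => //; first exact: Cr_on_cst.
by apply: Cr_on_prod => // i; exact: Cf.
Qed.

(** Each entry of the inverse is a cofactor divided by the determinant. *)
Lemma smooth_mxV n (f : V -> 'M[R]_n) : (forall x, U x -> f x \in unitmx) ->
  smooth_mx_on f -> smooth_mx_on (fun x => invmx (f x)).
Proof.
move=> uf Cf r i j.
have Cadj : Cr_on r U (fun x => cofactor (f x) j i).
  apply: Cr_onM => //; first exact: Cr_on_cst.
  apply: smooth_mx_det => s k l.
  by apply: Cr_on_ext (Cf s (lift j k) (lift i l)) => // x _; rewrite !mxE.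
have CV : Cr_on r U (fun x => (\det (f x))^-1).
  apply: Cr_onV (smooth_mx_det Cf r) => // x Ux.
  by have := uf x Ux; rewrite unitmxE unitfE.
apply: Cr_on_ext (Cr_onM oU CV Cadj) => // x Ux.
by rewrite /invmx uf// !mxE.
Qed.

Lemma smooth_mx_smooth m n (f : V -> 'M[R]_(m, n)) :
  smooth_mx_on f -> smooth_on U f.
Proof.
move=> Cf r.
apply: Cr_on_ext (Cr_on_sum (index_enum _) predT oU (fun i =>
  Cr_on_sum (index_enum _) predT oU (fun j =>
  Cr_onZl (delta_mx i j) oU (Cf r i j)))) => // x _.
by rewrite [RHS]matrix_sum_delta.
Qed.

End smooth_matrices.

Lemma smooth_mx_id (R : realType) m n (U : set 'M[R]_(m, n)) :
  smooth_mx_on U (fun X => X).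
Proof.
move=> r i j.
have lin : linear (fun X : 'M[R]_(m, n) => X i j : R).
  by move=> a X Y; rewrite !mxE.
pose f : {linear 'M[R]_(m, n) -> R} := HB.pack (fun X : 'M[R]_(m, n) => X i j : R)
  (GRing.isLinear.Build _ _ _ _ _ lin).
exact: (Cr_on_linear (f := f) r U (@coord_continuous R m n i j)).
Qed.

(** The entries of [f (g x)] are combinations of those of [g x] with constant coefficients, the
    entries of [f (delta_mx k l)]. *)
Lemma smooth_mx_linear (R : realType) (V : normedModType R) m n p q (U : set V)
  (f : {linear 'M[R]_(m, n) -> 'M[R]_(p, q)}) (g : V -> 'M[R]_(m, n)) :
  open U -> smooth_mx_on U g -> smooth_mx_on U (fun x => f (g x)).
Proof.
move=> oU Cg r i j.
apply: Cr_on_ext (Cr_on_sum (index_enum _) predT oU (fun k =>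
  Cr_on_sum (index_enum _) predT oU (fun l =>
  Cr_onZl (f (delta_mx k l) i j) oU (Cg r k l)))) => // x _.
rewrite [in RHS](matrix_sum_delta (g x)) linear_sum summxE; apply: eq_bigr => k _.
by rewrite linear_sum summxE; apply: eq_bigr => l _; rewrite linearZ mxE.
Qed.

Lemma continuous_det (R : realType) (V : normedModType R) n (f : V -> 'M[R]_n) :
  smooth_mx_on setT f -> continuous (fun x => \det (f x)).
Proof. by move=> Cf x; exact: (smooth_mx_det openT Cf 0%N). Qed.

Lemma open_unitmx (R : realType) (V : normedModType R) n (f : V -> 'M[R]_n) :
  smooth_mx_on setT f -> open [set x | f x \in unitmx].
Proof.
move=> Cf; rewrite (_ : [set x | _] = (fun x => \det (f x)) @^-1` [set y | y != 0]).
  by apply: open_comp; [move=> x _; exact: continuous_det|exact: open_neq].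
by apply/seteqP; split=> x /=; rewrite unitmxE unitfE.
Qed.

(** * Spectral theorem and inertia *)

(** Over the complex numbers the matrix is hermitian, hence unitarily diagonalizable with real
    spectrum. A real root of the complexified characteristic polynomial is a root of the original
    one. *)
Lemma symmetric_real_eigenvalue (R : realType) n (A : 'M[R]_n.+1) :
  A^T = A -> exists a, eigenvalue A a.
Proof.
move=> As; pose toC : {rmorphism R -> complex R} := real_complex R.
pose B := map_mx toC A.
have BR : B \is a mxOver Num.real.
  by apply/mxOverP => i j; rewrite mxE; apply/complex_realP; exists (A i j).
have Bh : B \is hermitianmx _ false Num.conj.
  apply: realsym_hermsym => //; apply/is_hermitianmxP.
  by rewrite expr0 scale1r map_mx_id// /B map_trmx As.
have /orthomx_spectralP BE := hermitian_normalmx Bh.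
have /mxOverP/(_ ord0 ord0)/complex_realP[a Da] := hermitian_spectral_diag_real Bh.
exists a; rewrite eigenvalue_root_char -(fmorph_root toC) map_char_poly.
rewrite -eigenvalue_root_char; apply/eigenvalueP.
set P := spectralmx B in BE; have uP : P \in unitmx := spectral_unit B.
have PB : P *m B = diag_mx (spectral_diag B) *m P.
  by rewrite [X in _ *m X]BE !mulmxA mulmxV// mul1mx.
exists (row ord0 P).
  by rewrite -row_mul PB; apply/rowP => j; rewrite mul_diag_mx !mxE Da.
(* A row of the invertible matrix [P] cannot vanish. *)
by have := row_free_unit P; rewrite uP => /row_freeP[Q PQ];
  apply/eqP => /(congr1 (mulmx^~ Q)); rewrite -row_mul PQ mul0mx => /rowP/(_ ord0)/eqP;
  rewrite !mxE eqxx oner_eq0.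
Qed.

Lemma row_dot_eq0 (R : realType) n (v : 'rV[R]_n) : (v *m v^T == 0) = (v == 0).
Proof.
apply/eqP/eqP => [/matrixP/(_ 0 0)|->]; last by rewrite mul0mx.
rewrite !mxE => /eqP; rewrite psumr_eq0 => [/allP v0|i _]; last first.
  by rewrite mxE -expr2 sqr_ge0.
apply/rowP => i; have := v0 i (mem_index_enum _).
by rewrite !mxE -expr2 sqrf_eq0 => /eqP.
Qed.

Lemma scalar_mx11 (R : realType) (M : 'M[R]_1) : M = (M 0 0)%:M.
Proof. by apply/matrixP => i j; rewrite !ord1 !mxE eqxx. Qed.

(* For [v <> e], the Householder reflection exchanging [e] and [v]. *)
Lemma reflection_with_first_row (R : realType) n (v : 'rV[R]_n.+1) :
  v *m v^T = 1%:M ->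
  exists H : 'M[R]_n.+1, [/\ H^T = H, H *m H = 1%:M & row 0 H = v].
Proof.
move=> v1; pose e : 'rV[R]_n.+1 := delta_mx 0 0; pose w := e - v.
have rowe (M : 'M[R]_n.+1) : row 0 M = e *m M by rewrite rowE.
have [w0|w0] := eqVneq w 0.
  exists 1%:M; split; rewrite ?trmx1 ?mulmx1//.
  by rewrite rowe mulmx1; apply/eqP; rewrite -subr_eq0 -/w w0.
have e1 : e *m e^T = 1%:M.
  by rewrite trmx_delta mul_delta_mx; apply/matrixP => i j; rewrite !ord1 !mxE.
pose c := (w *m w^T) 0 0; have wc : w *m w^T = c%:M by exact: scalar_mx11.
have c0 : c != 0.
  by apply: contraNneq w0 => c0; rewrite -row_dot_eq0 wc c0 raddf0.
(* As [e] and [v] are unit vectors with inner product [t], [c = 2 - 2 t] while [e *m w^T] is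
   [1 - t]. Hence the reflection along [w] sends [e] to [e - w = v]. *)
have ew : e *m w^T = (c / 2)%:M.
  have ve : v *m e^T = e *m v^T.
    apply/matrixP => i j; rewrite !ord1 !mxE; apply: eq_bigr => l _.
    by rewrite !mxE mulrC.
  have := wc; rewrite /w [(e - v)^T]linearB mulmxBl !mulmxBr e1 v1 ve.
  rewrite [e *m v^T]scalar_mx11; move: ((e *m v^T) 0 0) => t.
  move=> /matrixP/(_ 0 0); rewrite !mxE eqxx !mulr1n => ct.
  by apply/matrixP => i j; rewrite !ord1 !mxE eqxx !mulr1n; lra.
have wE : w = e - v by [].
clearbody c w.
exists (1%:M - (2 / c) *: (w^T *m w)); split.
- by rewrite linearB/= trmx1 linearZ/= trmx_mul trmxK.
- rewrite mulmxBl !mulmxBr mul1mx !mulmx1 mul1mx -!scalemxAl -!scalemxAr scalerA.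
  rewrite mulmxA -(mulmxA w^T) wc mul_mx_scalar -scalemxAl !scalerA.
  rewrite -addrA -opprD -[RHS]subr0; congr (_ - _).
  rewrite -!scalerBl -scalerDl [X in X *: _](_ : _ = 0) ?scale0r//.
  by field.
- rewrite rowe mulmxBr mulmx1 -scalemxAr mulmxA ew mul_scalar_mx scalerA.
  by rewrite (_ : _ * _ = 1) ?scale1r ?wE ?subKr//; field.
Qed.

Lemma symmetric_unit_eigenvector (R : realType) n (A : 'M[R]_n.+1) :
  A^T = A -> exists a (v : 'rV[R]_n.+1), v *m v^T = 1%:M /\ v *m A = a *: v.
Proof.
move=> /symmetric_real_eigenvalue[a /eigenvalueP[u uA u0]].
pose c := (u *m u^T) 0 0.
have uc : u *m u^T = c%:M by exact: scalar_mx11.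
have c0 : 0 < c.
  rewrite lt_neqAle; apply/andP; split.
    by apply: contraNneq u0 => c0; rewrite -row_dot_eq0 uc -c0 raddf0.
  by rewrite /c mxE sumr_ge0// => i _; rewrite mxE -expr2 sqr_ge0.
exists a, ((Num.sqrt c)^-1 *: u); split; last first.
  by rewrite -scalemxAl uA !scalerA mulrC.
rewrite linearZ -scalemxAl -scalemxAr uc scalerA scale_scalar_mx.
by rewrite -invfM -expr2 sqr_sqrtr ?ltW// mulVf ?gt_eqF.
Qed.

(** Deflation: conjugating by a reflection whose first row is a unit eigenvector makes the first
    basis vector an eigenvector. Symmetry then clears the first column as well as the first row, and
    the induction hypothesis handles the remaining block. *)
Lemma symmetric_orthogonal_diag (R : realType) n (A : 'M[R]_n) : A^T = A ->
  exists (P : 'M[R]_n) (d : 'rV[R]_n), P *m P^T = 1%:M /\ A = P^T *m diag_mx d *m P.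
Proof.
elim: n A => [|n IH] A As.
  by exists 1%:M, 0; split; apply/matrixP => -[].
have [a [v [v1 vA]]] := symmetric_unit_eigenvector As.
have [H [Hs HH Hv]] := reflection_with_first_row v1.
pose e : 'rV[R]_n.+1 := delta_mx 0 0.
have eH : e *m H = v by rewrite -Hv rowE.
pose B : 'M[R]_(1 + n) := H *m A *m H.
have Bs : B^T = B by rewrite /B !trmx_mul Hs As mulmxA.
have eB : e *m B = a *: e.
  by rewrite /B !mulmxA eH vA -scalemxAl -eH -mulmxA HH mulmx1.
have B0 j : B 0 j = a *+ (j == 0).
  have := congr1 (fun M : 'rV_n.+1 => M 0 j) eB.
  by rewrite -rowE !mxE /= mulr_natr => ->.
have BHA : H *m B *m H = A.
  by rewrite /B !mulmxA HH mul1mx -mulmxA HH mulmx1.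
clearbody B.
have [Q [d [QQ dE]]] := IH (drsubmx B) (etrans (trmx_drsub B) (congr1 drsubmx Bs)).
have BE : B = block_mx a%:M 0 0 (Q^T *m diag_mx d *m Q).
  rewrite -dE -[LHS]submxK; congr block_mx.
  - by apply/matrixP => i j; rewrite !ord1 !mxE lshift0 B0.
  - by apply/matrixP => i j; rewrite !ord1 !mxE lshift0 B0.
  - apply/matrixP => i j; rewrite !ord1 !mxE -[in LHS]Bs mxE lshift0 B0.
    by [].
pose P : 'M[R]_(1 + n) := block_mx 1%:M 0 0 Q.
have PP : P *m P^T = 1%:M.
  by rewrite /P tr_block_mx mulmx_block !trmx0 !mulmx0 !mul0mx trmx1 mulmx1 !addr0 !add0r
    QQ -scalar_mx_block.
pose dd : 'rV[R]_(1 + n) := row_mx a%:M d.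
have PdP : P^T *m diag_mx dd *m P = B.
  rewrite BE /P /dd diag_mx_row tr_block_mx !mulmx_block !trmx0 trmx1.
  rewrite ?(mulmx0,mul0mx,mulmx1,mul1mx,addr0,add0r).
  by congr block_mx; apply/matrixP => i j; rewrite !ord1 !mxE.
exists (P *m H : 'M[R]_n.+1), dd; split.
  by rewrite trmx_mul Hs mulmxA -(mulmxA P) HH mulmx1.
by rewrite trmx_mul Hs -[LHS]BHA -PdP !mulmxA.
Qed.

(** * Inertia read off an orthogonal diagonalization *)

Lemma char_poly_orthogonal_diag (R : realType) n (P : 'M[R]_n) (d : 'rV[R]_n) :
  P *m P^T = 1%:M ->
  char_poly (P^T *m diag_mx d *m P) = \prod_i ('X - (d 0 i)%:P).
Proof.
move=> PP; have PP' : P^T *m P = 1%:M by exact: mulmx1C.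
have <- : char_poly (diag_mx d) = \prod_i ('X - (d 0 i)%:P).
  rewrite char_poly_trig ?diag_mx_is_trig//.
  by apply: eq_bigr => i _; rewrite mxE eqxx mulr1n.
rewrite /char_poly /char_poly_mx; set Q := map_mx polyC P.
have QQ : map_mx polyC P^T *m Q = 1%:M by rewrite -map_mxM PP' map_mx1.
have -> : 'X%:M - map_mx polyC (P^T *m diag_mx d *m P) =
    map_mx polyC P^T *m ('X%:M - map_mx polyC (diag_mx d)) *m Q.
  by rewrite !map_mxM mulmxBr mulmxBl mul_mx_scalar -scalemxAl QQ scale_scalar_mx mulr1.
rewrite !det_mulmx mulrAC -det_mulmx QQ det1 mul1r.
by [].
Qed.

Lemma mup_prod_XsubC (R : realType) (I : Type) (s : seq I) (d : I -> R) x :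
  mup x (\prod_(i <- s) ('X - (d i)%:P)) = (\sum_(i <- s) (d i == x))%N.
Proof.
elim: s => [|i s IH].
  by rewrite !big_nil mupNroot// root1.
rewrite !big_cons mupM ?polyXsubC_eq0// ?monic_neq0 ?monic_prod_XsubC//.
by rewrite IH -['X - _]expr1 mup_XsubCX; case: eqP.
Qed.

(** Double counting: after the sums over roots and indices are exchanged, each [d i] occurs exactly
    once in the duplicate-free list of roots and contributes 1 when it satisfies [Q]. *)
Lemma sum_mup_rootsR (R : realType) n (d : 'I_n -> R) (Q : pred R) (p : {poly R}) :
  p = \prod_i ('X - (d i)%:P) ->
  (\sum_(x <- polyrcf.rootsR p | Q x) mup x p = #|[set i | Q (d i)]%SET|)%N.
Proof.
move=> pE; have p0 : p != 0 by rewrite pE monic_neq0// monic_prod_XsubC.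
rewrite (eq_bigr (fun x => \sum_i (d i == x)%N)%N); last first.
  by move=> x _; rewrite pE mup_prod_XsubC.
rewrite exchange_big /= -sum1dep_card [RHS]big_mkcond/=; apply: eq_bigr => i _.
rewrite big_mkcond /=.
have rd : d i \in polyrcf.rootsR p.
  rewrite -polyrcf.roots_on_rootsR// inE/= pE (bigD1 i)//= rootM.
  by rewrite root_XsubC eqxx.
rewrite (bigD1_seq (d i))//=; last exact: polyrcf.uniq_roots.
rewrite eqxx big1 ?addn0// => x /negPf xd; rewrite eq_sym xd.
by case: ifP.
Qed.

Lemma inertia_pos_diag (R : realType) n (P : 'M[R]_n) (d : 'rV[R]_n) :
  P *m P^T = 1%:M ->
  inertia_pos (P^T *m diag_mx d *m P) = #|[set i | 0 < d 0 i]%SET|.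
Proof.
move=> PP; apply: (sum_mup_rootsR (d := fun i => d 0 i) (fun x => 0 < x)).
exact: char_poly_orthogonal_diag.
Qed.

Lemma inertia_neg_diag (R : realType) n (P : 'M[R]_n) (d : 'rV[R]_n) :
  P *m P^T = 1%:M ->
  inertia_neg (P^T *m diag_mx d *m P) = #|[set i | d 0 i < 0]%SET|.
Proof.
move=> PP; apply: (sum_mup_rootsR (d := fun i => d 0 i) (fun x => x < 0)).
exact: char_poly_orthogonal_diag.
Qed.

(** * Existence of a point, by matching eigenvalues *)

Lemma card_le_inj_in (T T' : finType) (A : {set T}) (B : {set T'}) (y0 : T') :
  (#|A| <= #|B|)%N ->
  exists f : T -> T', {in A &, injective f} /\ {in A, forall x, f x \in B}.
Proof.
(* The two sets are matched by position in their enumerations; the default [y0] is never reached on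
   [A]. *)
move=> AB; exists (fun x => nth y0 (enum B) (index x (enum A))).
have idx x : x \in A -> (index x (enum A) < size (enum B))%N.
  by move=> xA; rewrite -cardE (leq_trans _ AB)// cardE index_mem mem_enum.
split=> [x y xA yA /eqP|x xA]; last by rewrite -mem_enum mem_nth ?idx.
rewrite nth_uniq ?idx ?enum_uniq// => /eqP /(congr1 (nth x (enum A))).
by rewrite !nth_index ?mem_enum.
Qed.

Lemma iSt_nonempty (R : realType) (n k : nat) (A : 'M[R]_n) (J : 'M[R]_k) :
  (k <= n)%N -> A^T = A -> J^T = J -> J *m J = 1%:M ->
  (inertia_pos J <= inertia_pos A)%N -> (inertia_neg J <= inertia_neg A)%N ->
  iSt A J !=set0.
Proof.
move=> kn As Js JJ.
have [P [d [PP ->]]] := symmetric_orthogonal_diag As.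
have [Q [e [QQ JE]]] := symmetric_orthogonal_diag Js.
have PP' : P^T *m P = 1%:M by exact: mulmx1C.
have QQ' : Q^T *m Q = 1%:M by exact: mulmx1C.
have e2 i : e 0 i ^+ 2 = 1.
  have : diag_mx e *m diag_mx e = 1%:M.
    have -> : diag_mx e = Q *m J *m Q^T.
      by rewrite JE !mulmxA QQ mul1mx -mulmxA QQ mulmx1.
    by rewrite !mulmxA -(mulmxA _ _ Q) QQ' mulmx1 -(mulmxA Q) JJ mulmx1 QQ.
  rewrite mulmx_diag => /matrixP/(_ i i).
  by rewrite !mxE eqxx !mulr1n expr2.
rewrite JE !inertia_pos_diag// !inertia_neg_diag//.
(* For [k = 0] the empty matrix works; otherwise [k <= n] provides an index [i0], the default value
   for both matchings. *)
case: k => [|k] in J Js JJ kn Q e QQ JE QQ' e2 *.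
  by move=> _ _; exists 0; apply/matrixP => -[].
pose i0 : 'I_n := Ordinal kn.
move=> /(card_le_inj_in i0)[fp [fpI fpP]] /(card_le_inj_in i0)[fn [fnI fnP]].
have epn i : ~~ (0 < e 0 i) -> e 0 i < 0.
  rewrite -leNgt lt_neqAle => ->; rewrite andbT.
  by apply/eqP => ei0; have /eqP := e2 i; rewrite ei0 expr0n/= eq_sym oner_eq0.
pose f i := if 0 < e 0 i then fp i else fn i.
(* Both sides are the common sign of the matched eigenvalues, since [e 0 i] squares to 1. *)
have fE i : d 0 (f i) / `|d 0 (f i)| = e 0 i.
  rewrite /f; case: ifPn => [ei|/epn ei].
    have : fp i \in [set i | 0 < d 0 i]%SET by rewrite fpP// inE.
    rewrite inE => di; rewrite gtr0_norm// divff ?gt_eqF//.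
    by apply/eqP; rewrite eq_sym -(eqrXn2 (n := 2))// ?ltW// e2 expr1n.
  have : fn i \in [set i | d 0 i < 0]%SET by rewrite fnP// inE.
  rewrite inE => di; rewrite ltr0_norm// invrN mulrN divff ?lt_eqF//.
  apply/eqP; rewrite eqr_oppLR eq_sym -(eqrXn2 (n := 2)) ?oppr_ge0 ?ltW//.
  by rewrite sqrrN e2 expr1n.
have d0 i : d 0 (f i) != 0.
  apply: contraNneq (oner_neq0 R) => di0.
  by rewrite -(e2 i) -fE di0 mul0r expr0n.
(* By [fE], equal images force equal signs, so both indices are matched by [fp] or both by [fn]. *)
have fI : injective f.
  move=> i j fij; have : e 0 i = e 0 j by rewrite -!fE fij.
  move: fij; rewrite /f; case: ifPn => ei; case: ifPn => ej //.
  - by move=> h _; apply: fpI; rewrite ?inE.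
  - by move=> _ h; rewrite h (negPf ej) in ei.
  - by move=> _ h; rewrite h ej in ei.
  - by move=> h _; apply: fnI; rewrite ?inE ?epn.
(* Dividing the basis vector [f j] by the square root of [|d 0 (f j)|] rescales that eigenvalue to
   its sign [e 0 j]. *)
pose S : 'M[R]_(n, k.+1) := \matrix_(i, j) ((i == f j)%:R / Num.sqrt `|d 0 (f j)|).
have SdS : S^T *m diag_mx d *m S = diag_mx e.
  apply/matrixP => j l; rewrite mxE (bigD1 (f l))//= big1 => [|i il]; last first.
    by rewrite [S _ _]mxE (negPf il) mul0r mulr0.
  rewrite addr0 mul_mx_diag !mxE eqxx (inj_eq fI) eq_sym.
  have [->|] := eqVneq j l; last by rewrite !mul0r.
  rewrite mulr1n -fE mul1r.
  have sq : Num.sqrt `|d 0 (f l)| ^+ 2 = `|d 0 (f l)| by rewrite sqr_sqrtr.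
  by rewrite mulrAC -invfM -expr2 sq mulrC.
exists (P^T *m S *m Q); rewrite /iSt /=.
rewrite !trmx_mul trmxK -!mulmxA (mulmxA P) PP mul1mx (mulmxA P) PP mul1mx.
by rewrite -SdS !mulmxA.
Qed.

(** * The Cayley chart *)

Section chart.
Context {R : realType} (n k : nat) (A : 'M[R]_n) (J : 'M[R]_k) (X0 : 'M[R]_(n, k)).
Context (As : A^T = A) (Js : J^T = J) (JJ : J *m J = 1%:M).
Context (X0J : X0^T *m A *m X0 = J).

Let L : 'M[R]_(k, n) := X0^T *m A.

(** Since [L *m X0 = J] and [J *m J = 1], [J *m L] is a left inverse of [X0]. The denominator is
    thus twice the identity at [X0], and stays invertible nearby. *)
Definition cayley_den (X : 'M[R]_(n, k)) : 'M[R]_k := J *m (L *m X) + 1%:M.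

(* If [M = J X0^T A X] is the [X0]-component of [X], its Cayley transform
   [Z = (M - 1) (M + 1)^-1] is the [X0]-component of [cayley X], and
   [cayley X = X (1 - Z) - X0]. *)
Definition cayley (X : 'M[R]_(n, k)) : 'M[R]_(n, k) :=
  2 *: (X *m invmx (cayley_den X)) - X0.

Definition uncayley_den (H : 'M[R]_(n, k)) : 'M[R]_k := 1%:M - J *m (L *m H).

(** This solves [H = X (1 - Z) - X0] for [X], with [Z] recovered as the [X0]-component [J L H] of
    [H]. *)
Definition uncayley (H : 'M[R]_(n, k)) : 'M[R]_(n, k) :=
  (X0 + H) *m invmx (uncayley_den H).

(* The form [A] evaluated on the component of [H] that is [A]-orthogonal to
   the columns of [X0]; hence it ignores shifts by [X0 M]. *)
Definition orthogonal_form (H : 'M[R]_(n, k)) : 'M[R]_k :=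
  H^T *m A *m H - (L *m H)^T *m J *m (L *m H).

Definition shear (a : R) (H : 'M[R]_(n, k)) : 'M[R]_(n, k) :=
  H + a *: (X0 *m (J *m orthogonal_form H)).

Let LX0 : L *m X0 = J. Proof. by []. Qed.

Let trL (H : 'M[R]_(n, k)) : (L *m H)^T = H^T *m A *m X0.
Proof. by rewrite !trmx_mul trmxK As mulmxA. Qed.

Let two0 : (2 : R) != 0. Proof. by rewrite pnatr_eq0. Qed.

Let JLX (X : 'M[R]_(n, k)) : J *m (L *m X) = cayley_den X - 1%:M.
Proof. by rewrite /cayley_den addrK. Qed.

Let JLH (H : 'M[R]_(n, k)) : J *m (L *m H) = 1%:M - uncayley_den H.
Proof. by rewrite /uncayley_den subKr. Qed.

(** This is [1 - Z = 2 (M + 1)^-1] for the Cayley transform [Z] of [M]; in particular [cayley] lands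
    in the domain of [uncayley]. *)
Lemma uncayley_den_cayley X : cayley_den X \in unitmx ->
  uncayley_den (cayley X) = 2 *: invmx (cayley_den X).
Proof.
move=> uX; rewrite /uncayley_den /cayley.
rewrite !mulmxBr LX0 JJ -!scalemxAr (mulmxA L) (mulmxA J) JLX.
rewrite mulmxBl mulmxV// mul1mx.
by apply/matrixP => i j; rewrite !mxE; ring.
Qed.

Lemma cayleyK X : cayley_den X \in unitmx -> uncayley (cayley X) = X.
Proof.
move=> uX; rewrite /uncayley uncayley_den_cayley// /cayley addrC subrK.
rewrite invmxZ ?unitmxZ ?unitmx_inv ?unitfE// invmxK -scalemxAl -scalemxAr scalerA.
by rewrite mulfV// scale1r mulmxKV.
Qed.

Lemma cayley_den_uncayley H : uncayley_den H \in unitmx ->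
  cayley_den (uncayley H) = 2 *: invmx (uncayley_den H).
Proof.
move=> uH; rewrite /cayley_den /uncayley (mulmxA L) (mulmxA J) !mulmxDr LX0 JJ JLH.
rewrite addrA mulmxBl mulmxV// mulmxDl mul1mx subrK.
by rewrite -mulr2n scaler_nat.
Qed.

Lemma uncayleyK H : uncayley_den H \in unitmx -> cayley (uncayley H) = H.
Proof.
move=> uH; rewrite /cayley cayley_den_uncayley// /uncayley.
rewrite invmxZ ?unitmxZ ?unitmx_inv ?unitfE// invmxK -scalemxAr scalerA mulfV// scale1r.
by rewrite mulmxKV// addrC addKr.
Qed.

(** With [Z = L H], both quadratic terms grow by the same amount [Z^T M + M^T Z + M^T J M], which
    cancels in the difference. *)
Lemma orthogonal_formD H M : orthogonal_form (H + X0 *m M) = orthogonal_form H.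
Proof.
have eA : (H + X0 *m M)^T *m A *m (H + X0 *m M) =
    H^T *m A *m H + ((L *m H)^T *m M + M^T *m (L *m H) + M^T *m J *m M).
  rewrite [(_ + _)^T]linearD/= [(X0 *m M)^T]trmx_mul mulmxDl mulmxDl !mulmxDr trL -!addrA; congr (_ + _).
  by rewrite !mulmxA /L -X0J !mulmxA.
have eL : (L *m (H + X0 *m M))^T *m J *m (L *m (H + X0 *m M)) =
    (L *m H)^T *m J *m (L *m H) + ((L *m H)^T *m M + M^T *m (L *m H) + M^T *m J *m M).
  rewrite mulmxDr (mulmxA L) LX0; move: (L *m H) => Z.
  rewrite [(_ + _)^T]linearD/= trmx_mul Js !mulmxDl !mulmxDr -!addrA; congr (_ + _).
  by rewrite !mulmxA -(mulmxA _ J J) JJ mulmx1 -(mulmxA M^T J J) JJ mulmx1.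
by rewrite /orthogonal_form eA eL opprD addrACA subrr addr0.
Qed.

(** The shear moves [H] by a multiple of the form [X0 M], which leaves [orthogonal_form] unchanged,
    so the opposite shear subtracts exactly the same term. *)
Lemma shearK a : cancel (shear a) (shear (- a)).
Proof.
move=> H; rewrite /shear scalemxAr orthogonal_formD.
by rewrite -scalemxAr scaleNr addrK.
Qed.

Lemma orthogonal_form_sym H : (orthogonal_form H)^T = orthogonal_form H.
Proof.
by rewrite /orthogonal_form [(_ - _)^T]linearB/= !trmx_mul !trmxK As Js !mulmxA.
Qed.

(** Congruence by the invertible [T = 1 - Z] clears the inverse, because [X T = X0 + H]. On
    expanding, the two copies of [J] cancel and the linear terms add up. *)
Lemma iSt_cayley X : cayley_den X \in unitmx ->
  iSt A J X <-> L *m shear (4^-1) (cayley X) + (L *m shear (4^-1) (cayley X))^T = 0.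
Proof.
move=> uX; set H := cayley X.
pose T := uncayley_den H.
have TE : T = 2 *: invmx (cayley_den X) by exact: uncayley_den_cayley.
have uT : T \in unitmx.
  by rewrite TE unitmxZ ?unitmx_inv// unitfE.
have XT : X *m T = X0 + H.
  by rewrite -[X in X *m _](cayleyK uX) mulmxKV.
have TD : T = 1%:M - J *m (L *m H) by [].
clearbody T H.
have LS : L *m shear (4^-1) H = L *m H + 4^-1 *: orthogonal_form H.
  by rewrite /shear mulmxDr -scalemxAr (mulmxA L X0) LX0 (mulmxA J J) JJ mul1mx.
(* The left side is [2 (L H + (L H)^T) + Q] with [Q] the symmetric [orthogonal_form]. The factor
   [4^-1] in the shear is right because [Q / 4] and its transpose, doubled, give [Q]. *)
have key : T^T *m (X^T *m A *m X - J) *m T =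
    2 *: (L *m shear (4^-1) H + (L *m shear (4^-1) H)^T).
  have -> : T^T *m (X^T *m A *m X - J) *m T =
      (X *m T)^T *m A *m (X *m T) - T^T *m J *m T.
    by rewrite mulmxBr mulmxBl trmx_mul !mulmxA.
  have eA : (X0 + H)^T *m A *m (X0 + H) =
      H^T *m A *m H + (J + (L *m H + (L *m H)^T)).
    rewrite [(_ + _)^T]linearD/= mulmxDl mulmxDl !mulmxDr trL X0J.
    by rewrite [RHS]addrC -!addrA [H^T *m A *m X0 + _]addrC /L.
  have eT : T^T *m J *m T =
      (L *m H)^T *m J *m (L *m H) + (J - (L *m H + (L *m H)^T)).
    rewrite TD; move: (L *m H) => Z.
    rewrite [(_ - _)^T]linearB/= trmx1 trmx_mul Js mulmxBl mul1mx -(mulmxA _ J J) JJ mulmx1.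
    rewrite mulmxBl !mulmxBr !mulmx1 !mulmxA JJ mul1mx.
    move: (Z^T *m J *m Z) Z^T => Q Zt.
    by apply/matrixP => i j; rewrite !mxE; ring.
  rewrite XT eA eT LS [(_ + _ *: _)^T]linearD/= [(_ *: _)^T]linearZ/= orthogonal_form_sym.
  rewrite opprD addrACA -/(orthogonal_form H).
  move: (orthogonal_form H) (L *m H) => N Z.
  apply/matrixP => i j; rewrite !mxE; lra.
split=> [XS|LS0].
  have := key; rewrite -[X^T *m A *m X]/(X^T *m A *m X) XS subrr mulmx0 mul0mx.
  by move=> /esym/eqP; rewrite scaler_eq0 (negPf two0)/= => /eqP.
move: key; rewrite LS0 scaler0 => /(congr1 (fun M => M *m invmx T)).
rewrite mulmxK// mul0mx => /(congr1 (fun M => invmx T^T *m M)).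
by rewrite mulKmx ?unitmx_tr// mulmx0 => /eqP; rewrite subr_eq0 => /eqP.
Qed.

End chart.

(** * Linear equations as coordinate slices *)

(** Gaussian elimination factors [G] as [C], then [pid_mx r], then an invertible matrix, so
    [v G = 0] says that the first [r] coordinates of [v C] vanish. Reversing the columns of [C]
    makes them the last ones. *)
Lemma vanishing_last_coords (R : realType) (N r : nat) (G : 'M[R]_(N, r)) :
  \rank G = r ->
  exists2 B : 'M[R]_N, B \in unitmx & forall v : 'rV[R]_N,
    v *m G = 0 <-> forall j : 'I_N, (N - r <= j)%N -> (v *m B) 0 j = 0.
Proof.
move=> rG; pose C := col_ebase G.
(* Full column rank ensures that the natural-number subtraction [N - r] is not truncated. *)
have rN : (r <= N)%N by rewrite -[X in (X <= _)%N]rG rank_leq_row.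
exists (\matrix_(i, j) C i (rev_ord j)).
  have -> : \matrix_(i, j) C i (rev_ord j) = col_perm (perm rev_ord_inj) C.
    by apply/matrixP => i j; rewrite !mxE permE.
  by rewrite col_permE unitmx_mul col_ebase_unit unitmx_perm.
move=> v.
have vB j : (v *m (\matrix_(i, j) C i (rev_ord j))) 0 j = (v *m C) 0 (rev_ord j).
  by rewrite !mxE; apply: eq_bigr => i _; rewrite mxE.
have vG : v *m G = 0 <-> v *m C *m (pid_mx r : 'M[R]_(N, r)) = 0.
  have GE := mulmx_ebase G; rewrite rG in GE.
  rewrite -{1}GE !mulmxA; split=> [/(congr1 (mulmx^~ (invmx (row_ebase G))))|->].
    by rewrite mulmxK ?row_ebase_unit// mul0mx.
  by rewrite mul0mx.
rewrite vG; move: (v *m C) vB => u vB.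
have uE (l : 'I_r) : (u *m (pid_mx r : 'M[R]_(N, r))) 0 l = u 0 (widen_ord rN l).
  rewrite mxE (bigD1 (widen_ord rN l))//= big1 => [|i il].
    by rewrite mxE /= eqxx ltn_ord mulr1 addr0.
  rewrite mxE (_ : (i == l :> nat) = false) ?mulr0//.
  by apply/negbTE; apply: contraNneq il => il; apply/eqP/val_inj.
split=> [/rowP u0 j Nj|u0].
  have jr : (rev_ord j < r)%N by rewrite /=; have := ltn_ord j; lia.
  have := u0 (Ordinal jr); rewrite uE vB [RHS]mxE => <-.
  by congr (u 0 _); apply: val_inj.
apply/rowP => l; rewrite [RHS]mxE uE -(rev_ordK (widen_ord rN l)) -vB u0//=.
by have := ltn_ord l; lia.
Qed.

(** These pairs index the independent entries of a symmetric matrix, diagonal included. *)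
Definition upper_pair (k : nat) : Type := {p : 'I_k * 'I_k | (p.1 <= p.2)%N}.
HB.instance Definition _ k := Finite.on (upper_pair k).

Lemma card_upper_pair k : #|{: upper_pair k}| = ((k * (k + 1))./2)%N.
Proof.
rewrite card_sig -sum1_card big_mkcond/=.
rewrite -(pair_bigA _ (fun i j : 'I_k => if (i <= j)%N then 1%N else 0%N))/= exchange_big/=.
rewrite (eq_bigr (fun j : 'I_k => j.+1)) => [|j _]; last first.
  by rewrite -big_mkcond -(big_ord_widen k (fun=> 1%N) (ltn_ord j)) sum1_card card_ord.
rewrite addn1 mulnC -bin2 -bin2_sum big_nat_recl// add0n.
by rewrite big_mkord.
Qed.

(** The rank is full because [X] to [M X + (M X)^T] is onto the symmetric matrices: [X = M' Y] gives
    [Y + Y^T], and any symmetric matrix has this form. *)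
Lemma symmetrized_map_rank (R : realType) (n k : nat)
    (M : 'M[R]_(k, n)) (M' : 'M[R]_(n, k)) : M *m M' = 1%:M ->
  exists2 G : 'M[R]_(n * k, #|{: upper_pair k}|), \rank G = #|{: upper_pair k}| &
    forall X : 'M[R]_(n, k), mxvec X *m G = 0 <-> M *m X + (M *m X)^T = 0.
Proof.
move=> MM; set r := #|_|.
pose f (v : 'rV[R]_(n * k)) : 'rV[R]_r := \row_t
  (let p := val (enum_val t : upper_pair k) in
   (M *m vec_mx v) p.1 p.2 + (M *m vec_mx v) p.2 p.1).
have fM v t (p := val (enum_val t : upper_pair k)) :
    f v 0 t = (M *m vec_mx v) p.1 p.2 + (M *m vec_mx v) p.2 p.1 by rewrite mxE.
have flin : linear f.
  move=> a u v; apply/rowP => t; rewrite fM [RHS]mxE [(a *: f u) 0 t]mxE !fM.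
  rewrite linearP mulmxDr -scalemxAr; move: (M *m vec_mx u) (M *m vec_mx v) => P Q.
  by rewrite !mxE; ring.
pose F : {linear _ -> _} := HB.pack f (GRing.isLinear.Build _ _ _ _ _ flin).
pose G := lin1_mx F.
have fE v : v *m G = f v by rewrite mul_rV_lin1.
exists G.
  apply/eqP; rewrite -/(row_full G); apply/row_fullP.
  pose g (w : 'rV[R]_r) (p : 'I_k * 'I_k) : R :=
    if insub p is Some t then w 0 (enum_rank (t : upper_pair k)) else 0.
  (* [Y w] is upper triangular, as [g] is 0 on pairs below the diagonal. The diagonal is halved
     because symmetrizing doubles it. *)
  pose Y w : 'M[R]_k := \matrix_(i, j) (g w (i, j) / (1 + (i == j)%:R)).
  have fY w : f (mxvec (M' *m Y w)) = w.
    apply/rowP => t; rewrite fM mxvecK mulmxA MM mul1mx.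
    set p := val _; rewrite !mxE.
    have gp : g w (p.1, p.2) = w 0 t.
      by rewrite /g -surjective_pairing valK enum_valK.
    have [pe|pe] := eqVneq p.1 p.2; last first.
      rewrite gp [g w (p.2, p.1)]/g insubF ?mul0r ?addr0 ?divr1//=.
      apply/negbTE; rewrite -ltnNge ltn_neqAle (inj_eq val_inj) pe/=.
      exact: (valP (enum_val t)).
    by rewrite -pe in gp *; rewrite gp /=; field.
  exists (\matrix_i mxvec (M' *m Y (delta_mx 0 i))).
  apply/row_matrixP => i; rewrite row_mul rowK fE fY.
  by rewrite row1.
move=> X; rewrite fE; split=> [/rowP f0|X0]; last first.
  apply/rowP => t; rewrite fM mxvecK [RHS]mxE; set p := val _.
  by have /matrixP/(_ p.1 p.2) := X0; rewrite mxE [_^T _ _]mxE [RHS]mxE.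
have sym0 (i j : 'I_k) : (i <= j)%N -> (M *m X) i j + (M *m X) j i = 0.
  move=> ij; have := f0 (enum_rank (Sub (i, j) ij : upper_pair k)).
  by rewrite fM mxvecK enum_rankK => ->; rewrite mxE.
apply/matrixP => i j; rewrite mxE [_^T _ _]mxE [RHS]mxE.
by have [/sym0//|/ltnW/sym0] := leqP i j; rewrite addrC.
Qed.

(** * The indefinite Stiefel manifold *)

Lemma closed_iSt (R : realType) (n k : nat) (A : 'M[R]_n) (J : 'M[R]_k) :
  closed (iSt A J).
Proof.
have Cf : smooth_mx_on setT (fun X : 'M[R]_(n, k) => X^T *m A *m X).
  apply: smooth_mxM; [exact: openT| |exact: smooth_mx_id].
  apply: smooth_mxM; [exact: openT| |exact: smooth_mx_cst].
  by apply: smooth_mx_tr; [exact: openT|exact: smooth_mx_id].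
have -> : iSt A J = (fun X => X^T *m A *m X) @^-1` [set J] by [].
have C0 := smooth_mx_smooth openT Cf 0%N.
apply: preimage_closed => [X _|]; first exact: C0.
exact/accessible_closed_set1/hausdorff_accessible/norm_hausdorff.
Qed.

(** * Smoothness of the chart and its inverse *)

Section chart_smooth.
Context {R : realType} (n k : nat) (A : 'M[R]_n) (J : 'M[R]_k) (X0 : 'M[R]_(n, k)).
Context {V : normedModType R} (U : set V) (oU : open U).
Context (g : V -> 'M[R]_(n, k)) (Cg : smooth_mx_on U g).

Lemma smooth_shear a : smooth_mx_on U (fun x => shear A J X0 a (g x)).
Proof.
apply: smooth_mxD => //; apply: smooth_mxZ => //; apply: smooth_mxM => //.
  exact: smooth_mx_cst.
apply: smooth_mxM => //; first exact: smooth_mx_cst.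
have CL : smooth_mx_on U (fun x => X0^T *m A *m g x).
  by apply: smooth_mxM => //; exact: smooth_mx_cst.
apply: smooth_mxD => //.
  apply: smooth_mxM => //; apply: smooth_mxM => //; last exact: smooth_mx_cst.
  exact: smooth_mx_tr.
apply: smooth_mxN => //; apply: smooth_mxM => //; apply: smooth_mxM => //.
  exact: smooth_mx_tr.
exact: smooth_mx_cst.
Qed.

Lemma smooth_cayley_den : smooth_mx_on U (fun x => cayley_den A J X0 (g x)).
Proof.
apply: smooth_mxD => //; last exact: smooth_mx_cst.
apply: smooth_mxM => //; first exact: smooth_mx_cst.
by apply: smooth_mxM => //; exact: smooth_mx_cst.
Qed.

Lemma smooth_uncayley_den : smooth_mx_on U (fun x => uncayley_den A J X0 (g x)).
Proof.
apply: smooth_mxD => //; first exact: smooth_mx_cst.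
apply: smooth_mxN => //; apply: smooth_mxM => //; first exact: smooth_mx_cst.
by apply: smooth_mxM => //; exact: smooth_mx_cst.
Qed.

Lemma smooth_cayley : (forall x, U x -> cayley_den A J X0 (g x) \in unitmx) ->
  smooth_mx_on U (fun x => cayley A J X0 (g x)).
Proof.
move=> ug; apply: smooth_mxD => //; last exact: smooth_mx_cst.
apply: smooth_mxZ => //; apply: smooth_mxM => //.
by apply: smooth_mxV => //; exact: smooth_cayley_den.
Qed.

Lemma smooth_uncayley : (forall x, U x -> uncayley_den A J X0 (g x) \in unitmx) ->
  smooth_mx_on U (fun x => uncayley A J X0 (g x)).
Proof.
move=> ug; apply: smooth_mxM => //.
  by apply: smooth_mxD => //; exact: smooth_mx_cst.
by apply: smooth_mxV => //; exact: smooth_uncayley_den.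
Qed.

End chart_smooth.

Lemma iSt_chart (R : realType) (n k : nat) (A : 'M[R]_n) (J : 'M[R]_k)
    (X0 : 'M[R]_(n, k)) :
  A^T = A -> J^T = J -> J *m J = 1%:M -> iSt A J X0 ->
  exists (U : set 'M[R]_(n, k)) (O : set 'rV[R]_(n * k))
         (phi : 'M[R]_(n, k) -> 'rV[R]_(n * k)) (psi : 'rV[R]_(n * k) -> 'M[R]_(n, k)),
    [/\ smooth_diffeo U O phi psi, U X0 &
      forall X, U X -> (iSt A J X <->
        forall j : 'I_(n * k),
          (n * k - (k * (k + 1))./2 <= j)%N -> phi X ord0 j = 0)].
Proof.
move=> As Js JJ X0S.
have LX0 : (X0^T *m A) *m (X0 *m J) = 1%:M by rewrite mulmxA X0S JJ.
have [G rG GE] := symmetrized_map_rank LX0.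
have [B uB BE] := vanishing_last_coords rG.
pose chart X := shear A J X0 4^-1 (cayley A J X0 X).
pose unflat (y : 'rV[R]_(n * k)) := shear A J X0 (- 4^-1) (vec_mx (y *m invmx B)).
pose U := [set X | cayley_den A J X0 X \in unitmx].
(* The shear and the linear coordinate change are global bijections; only the Cayley step restricts
   the domains, and [O] is the image of [U]. *)
pose O := [set y | uncayley_den A J X0 (unflat y) \in unitmx].
have Cun W : open W -> smooth_mx_on W unflat.
  move=> oW; apply: smooth_shear => //.
  apply: (smooth_mx_linear vec_mx) => //; apply: smooth_mxM => //.
    exact: smooth_mx_id.
  exact: smooth_mx_cst.
have oU : open U.
  by apply: open_unitmx; apply: smooth_cayley_den; [exact: openT|exact: smooth_mx_id].
have oO : open O.
  by apply: open_unitmx; apply: smooth_uncayley_den; [exact: openT|exact/Cun/openT].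
have flatK H : unflat (mxvec (shear A J X0 4^-1 H) *m B) = H.
  by rewrite /unflat mulmxK// mxvecK shearK.
have unflatK y : mxvec (shear A J X0 4^-1 (unflat y)) *m B = y.
  rewrite /unflat -[X in shear _ _ _ X (shear _ _ _ _ _)]opprK shearK//.
  by rewrite vec_mxK mulmxKV.
exists U, O, (fun X => mxvec (chart X) *m B), (fun y => uncayley A J X0 (unflat y)).
split; first split; first split => //.
- apply: smooth_mx_smooth => //; apply: smooth_mxM => //; last exact: smooth_mx_cst.
  apply: (smooth_mx_linear mxvec) => //; apply: smooth_shear => //.
  by apply: smooth_cayley => //; exact: smooth_mx_id.
- by apply: smooth_mx_smooth => //; apply: smooth_uncayley => //; exact: Cun.
- split=> [X UX|y Oy|X UX|y Oy].
  + rewrite /O /= flatK uncayley_den_cayley// unitmxZ ?unitmx_inv//.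
    by rewrite unitfE pnatr_eq0.
  + rewrite /U /= cayley_den_uncayley// unitmxZ ?unitmx_inv//.
    by rewrite unitfE pnatr_eq0.
  + by rewrite flatK cayleyK.
  + by rewrite /chart uncayleyK// unflatK.
- rewrite /U /= /cayley_den X0S JJ -mulr2n -scaler_nat unitmxZ ?unitmx1//.
  by rewrite unitfE pnatr_eq0.
- move=> X UX; rewrite -card_upper_pair -BE GE.
  exact: iSt_cayley.
Qed.

Unset Implicit Arguments.

Theorem proposition2p2 (R : realType) (n k : nat)
    (hk : (1 <= k)%N) (hkn : (k <= n)%N)
    (A : 'M[R]_n) (hAsym : A^T = A) (hAns : A \in unitmx)
    (J : 'M[R]_k) (hJsym : J^T = J) (hJ2 : J *m J = 1%:M)
    (hpos : (inertia_pos J <= inertia_pos A)%N)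
    (hneg : (inertia_neg J <= inertia_neg A)%N) :
  closed (iSt A J) /\
  embedded_submanifold (iSt A J) (n * k - (k * (k + 1))./2)%N.
Proof.
split; first exact: closed_iSt.
split; [exact: iSt_nonempty|exact: leq_subr|].
by move=> X0 X0S; exact: iSt_chart.
Qed.
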